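(* Let $n\ge1$. We have $$|s^{-1}(\mathrm{Av}_n(132,231,312))|=F_{n+1},$$ where $F_j$ denotes the $j$-th Fine number. Moreover, for every integer $m\ge 0$, the number of permutations in $s^{-1}(\mathrm{Av}_n(132,231,312))$ with exactly $m$ descents is $$g_{n,m}=\sum_{k=0}^{\lfloor (n-1)/2\rfloor}N_k(n-k,m-k+1),$$ and the number of permutations in $s^{-1}(\mathrm{Av}_n(132,231,312))$ with exactly $m$ peaks is $$h_{n,m}=\frac{2^{n-2m-1}}{n+2}\binom{n+2}{m+1}\binom{n-m-1}{m}.$$
   Context: $S_n$ is the set of permutations of $\{1,\ldots,n\}$, written as words. The stack-sorting map $s$ is defined recursively on words of distinct positive integers: $s$ sends the empty word to itself, and if $\pi=LNR$ where $N$ is the largest entry of $\pi$, then $s(\pi)=s(L)s(R)N$. Thus $s$ maps $S_n$ to $S_n$, and $s^{-1}(A)=\{\sigma\in S_n: s(\sigma)\in A\}$ for $A\subseteq S_n$. $\mathrm{Av}_n(\tau^{(1)},\ldots,\tau^{(r)})$ is the set of permutations in $S_n$ avoiding (in the classical sense) all the patterns $\tau^{(1)},\ldots,\tau^{(r)}$. A descent of $\pi\in S_n$ is an index $i\in\{1,\ldots,n-1\}$ with $\pi_i>\pi_{i+1}$; a peak is an index $i\in\{2,\ldots,n-1\}$ with $\pi_{i-1}<\pi_i>\pi_{i+1}$. The Fine numbers $F_n$ are defined by $\sum_{n\geq 0}F_nx^n=\frac{1}{x}\,\frac{1-\sqrt{1-4x}}{3-\sqrt{1-4x}}$. The generalized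 Narayana numbers are $N_k(n,r)=\frac{k+1}{n}\binom{n}{r+k}\binom{n}{r-1}$. Binomial coefficients $\binom ab$ are $0$ unless $0\le b\le a$. *)

(* Defs.v *)
From mathcomp Require Import all_boot all_order all_algebra finmap.
Set Implicit Arguments.
Unset Strict Implicit.
Unset Printing Implicit Defensive.
Import Order.TTheory GRing.Theory Num.Theory.

Local Open Scope nat_scope.
Local Open Scope fset_scope.

Definition word := seq nat.

Definition Sn (n : nat) : {fset word} := [fset w in permutations (iota 1 n)].

Definition max_entry (w : word) : nat := \max_(x <- w) x.

(* The first argument is fuel; the length of the word suffices (see
   stack_sort_cat for the recursion of the stack-sorting map). *)
Fixpoint stack_sort_rec (k : nat) (w : word) : word :=
  if k is k'.+1 then
    if w is [::] then [::] else
      let N := max_entry w in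
      let i := index N w in
      stack_sort_rec k' (take i w) ++ stack_sort_rec k' (drop i.+1 w) ++ [:: N]
  else [::].

Definition stack_sort (w : word) : word := stack_sort_rec (size w) w.

Lemma stack_sort_rec_fuel k l (w : word) :
  size w <= k -> size w <= l -> stack_sort_rec k w = stack_sort_rec l w.
Proof.
elim: k l w => [|k IH] [|l] [|x w] //= hk hl.
set N := max_entry _; set i := (if x == N then 0 else _).
have i_lt : i < (size w).+1.
  have: N \in x :: w.
    rewrite /N /max_entry.
    elim: (w) (x) => [|y v IHv] z; first by rewrite big_seq1 mem_seq1.
    rewrite big_cons; case: leqP => _; last by rewrite mem_head.
    by rewrite in_cons IHv orbT.
  by rewrite -index_mem.
have ht : size (if i is i'.+1 then x :: take i' w else [::]) <= size w.
  by case: (i) i_lt => //= j; rewrite ltnS size_take_min => hj; rewrite gtn_min hj.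
have hd : size (drop i w) <= size w by rewrite size_drop leq_subr.
by congr (_ ++ (_ ++ _)); apply: IH; rewrite ?(leq_trans ht) ?(leq_trans hd).
Qed.

Lemma stack_sort_nil : stack_sort [::] = [::].
Proof. by []. Qed.

Lemma stack_sort_cat (L R : word) (N : nat) :
  all (fun x => x < N) L -> all (fun x => x < N) R ->
  stack_sort (L ++ N :: R) = stack_sort L ++ stack_sort R ++ [:: N].
Proof.
move=> hL hR.
have hmax : max_entry (L ++ N :: R) = N.
  apply/eqP; rewrite eqn_leq /max_entry; apply/andP; split.
    apply/bigmax_leqP_seq => x; rewrite mem_cat in_cons => /orP[|/orP[/eqP->|]] // xin _.
      exact: ltnW (allP hL _ xin).
    exact: ltnW (allP hR _ xin).
  by apply: (@leq_bigmax_seq _ _ predT id); rewrite // mem_cat mem_head orbT.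
have NL : N \notin L by apply/negP => /(allP hL); rewrite ltnn.
have hidx : index N (L ++ N :: R) = size L.
  by rewrite index_cat (negbTE NL) /= eqxx addn0.
rewrite /stack_sort [size (L ++ _)]size_cat /= addnS.
have -> : forall k, stack_sort_rec k.+1 (L ++ N :: R) =
    stack_sort_rec k L ++ stack_sort_rec k R ++ [:: N].
  move=> k; have -> : stack_sort_rec k.+1 (L ++ N :: R) =
    let M := max_entry (L ++ N :: R) in let i := index M (L ++ N :: R) in
    stack_sort_rec k (take i (L ++ N :: R)) ++
    stack_sort_rec k (drop i.+1 (L ++ N :: R)) ++ [:: M] by case: (L).
  rewrite /= hmax hidx take_size_cat //.
  by rewrite drop_cat ltnNge leqnSn subSnn /= drop0.
by congr (_ ++ (_ ++ _)); apply: stack_sort_rec_fuel; rewrite ?leq_addr ?leq_addl.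
Qed.

Definition order_iso (u v : word) : bool :=
  (size u == size v) &&
  [forall i : 'I_(size u), forall j : 'I_(size u),
     (nth 0 u i < nth 0 u j) == (nth 0 v i < nth 0 v j)].

Definition contains (w tau : word) : bool :=
  [exists m : (size w).-tuple bool, order_iso (mask m w) tau].

Lemma containsP (w tau : word) :
  reflect (exists2 u, subseq u w & order_iso u tau) (contains w tau).
Proof.
apply: (iffP existsP) => [[m hm]|[u /subseqP[m sm ->] hu]].
  by exists (mask m w); rewrite ?mask_subseq.
by exists (Tuple (introT eqP sm)).
Qed.

Definition Av (n : nat) (taus : seq word) : {fset word} :=
  [fset w in Sn n | all (fun tau => ~~ contains w tau) taus].

Definition stack_preim (n : nat) (A : {fset word}) : {fset word} :=
  [fset w in Sn n | stack_sort w \in A].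

(* Entries of a word are indexed from 1. *)
Definition entry (w : word) (i : nat) : nat := nth 0 w i.-1.

Definition descents (w : word) : seq nat :=
  [seq i <- iota 1 (size w - 1) | entry w i > entry w i.+1].

Definition peaks (w : word) : seq nat :=
  [seq i <- iota 2 (size w - 2) |
     (entry w i.-1 < entry w i) && (entry w i > entry w i.+1)].

Local Close Scope fset_scope.
Local Open Scope ring_scope.

(* The integer arguments can be negative: m - k, for instance, with k > m. *)
Definition binz (a b : int) : rat :=
  if 0 <= b <= a then 'C(`|a|%N, `|b|%N)%:R else 0.

Definition narayana (k n : nat) (r : int) : rat :=
  k.+1%:R / n%:R * binz n%:Z (r + k%:Z) * binz n%:Z (r - 1).

(* Formal power series over the rationals, as coefficient sequences. *)
Definition fps := nat -> rat.

Definition fps_poly (p : {poly rat}) : fps := fun n => p`_n.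
Definition fps_sub (a b : fps) : fps := fun n => a n - b n.
Definition fps_mul (a b : fps) : fps :=
  fun n => \sum_(i < n.+1) a i * b (n - i)%N.

Fixpoint fps_rec_prefix (step : seq rat -> rat) (n : nat) : seq rat :=
  if n is n'.+1 then
    let c := fps_rec_prefix step n' in rcons c (step c)
  else [::].

(* The series whose n-th coefficient is step [:: c_0; ...; c_(n-1)]. *)
Definition fps_rec (step : seq rat -> rat) : fps :=
  fun n => step (fps_rec_prefix step n).

(* The solution q of q * b = a; meaningful when b 0 != 0. *)
Definition fps_div (a b : fps) : fps :=
  fps_rec (fun q => (a (size q) - \sum_(i < size q) q`_i * b (size q - i)%N) / b 0%N).

(* The solution c of c * c = a with c 0 = 1; meaningful when a 0 = 1. *)
Definition fps_sqrt (a : fps) : fps :=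
  fps_rec (fun c =>
    if c is [::] then 1
    else (a (size c) - \sum_(1 <= i < size c) c`_i * c`_(size c - i)) / 2%:R).

Lemma size_fps_rec_prefix step n : size (fps_rec_prefix step n) = n.
Proof. by elim: n => //= n IH; rewrite size_rcons IH. Qed.

Lemma nth_fps_rec_prefix step n i :
  (i < n)%N -> (fps_rec_prefix step n)`_i = fps_rec step i.
Proof.
elim: n => //= n IH; rewrite ltnS nth_rcons size_fps_rec_prefix leq_eqVlt.
by case: ltngtP => //= [/IH|-> _].
Qed.

Lemma fps_divK (a b : fps) : b 0%N != 0 -> fps_mul (fps_div a b) b =1 a.
Proof.
move=> b0 n; rewrite /fps_mul big_ord_recr /= subnn {2}/fps_div /fps_rec.
rewrite size_fps_rec_prefix divfK // addrC -[RHS](subrK (\sum_(i < n) fps_div a b i * b (n - i)%N)).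
congr (_ - _ + _); apply: eq_bigr => i _.
by rewrite nth_fps_rec_prefix.
Qed.

Lemma fps_sqrt0 (a : fps) : fps_sqrt a 0%N = 1.
Proof. by []. Qed.

Lemma fps_sqrtK (a : fps) :
  a 0%N = 1 -> fps_mul (fps_sqrt a) (fps_sqrt a) =1 a.
Proof.
move=> a0 [|n]; first by rewrite /fps_mul big_ord1 fps_sqrt0 a0 mulr1.
have hS : fps_sqrt a n.+1 = (a n.+1 -
    \sum_(1 <= i < n.+1) fps_sqrt a i * fps_sqrt a (n.+1 - i)%N) / 2%:R.
  rewrite {1}/fps_sqrt /fps_rec; set c := fps_rec_prefix _ _.
  have sc : size c = n.+1 by rewrite size_fps_rec_prefix.
  have -> : (if c is [::] then 1 else (a (size c) -
      \sum_(1 <= i < size c) c`_i * c`_(size c - i)) / 2%:R) = (a n.+1 -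
      \sum_(1 <= i < n.+1) c`_i * c`_(n.+1 - i)) / 2%:R.
    by move: sc; case: (c) => // x s <-.
  congr ((_ - _) / _); rewrite !big_nat; apply: eq_bigr => i /andP[i1 i2].
  rewrite !nth_fps_rec_prefix // ltn_subrL i1 //.
rewrite /fps_mul -(big_mkord predT (fun i => fps_sqrt a i * fps_sqrt a (n.+1 - i)%N)).
rewrite big_nat_recr //= big_ltn // subn0 subnn fps_sqrt0 mul1r mulr1.
set T := \sum_(1 <= i < _) _ in hS *.
rewrite addrAC -mulr2n -[_ *+ 2]mulr_natr hS divfK ?subrK //.
Qed.

(* The series sqrt (1 - 4 x). *)
Definition sqrt_1m4x : fps := fps_sqrt (fps_poly (1 - 4%:R *: 'X)).

Definition fine_quotient : fps :=
  fps_div (fps_sub (fps_poly 1) sqrt_1m4x) (fps_sub (fps_poly 3%:R) sqrt_1m4x).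

(* Division by x is a shift, since the quotient has zero constant term. *)
Definition fine (n : nat) : rat := fine_quotient n.+1.

Lemma sqrt_1m4xK :
  fps_mul sqrt_1m4x sqrt_1m4x =1 fps_poly (1 - 4%:R *: 'X).
Proof.
by apply: fps_sqrtK; rewrite /fps_poly coefB coef1 coefZ coefX mulr0 subr0.
Qed.

Lemma fine_quotientK :
  fps_mul fine_quotient (fps_sub (fps_poly 3%:R) sqrt_1m4x)
    =1 fps_sub (fps_poly 1) sqrt_1m4x.
Proof.
apply: fps_divK; rewrite /fps_sub /fps_poly /sqrt_1m4x fps_sqrt0.
by rewrite -polyC_natr coefC.
Qed.

Lemma fine_quotient0 : fine_quotient 0%N = 0.
Proof.
rewrite /fine_quotient /fps_div /fps_rec /= big_ord0 subr0.
by rewrite /fps_sub /fps_poly /sqrt_1m4x fps_sqrt0 coef1 subrr mul0r.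
Qed.

(* Main.v *)
(* The permutations avoiding 132, 231 and 312 are the hooks
   h, h - 1, ..., 1, h + 1, ..., n. Splitting a word at its maximum turns the
   fibre of the stack-sorting map over a hook into a recursion in which the
   descents or peaks created by the maximum depend only on which of the two
   sides are empty. If N = x (1 + u N + d N^2) enumerates the fibres of the increasing
   words, where u and d weight the nodes with one and two nonempty sides, the
   recursion is solved by (d x)^j N^(j+1) for the hooks with h = j + 1.
   Lagrange inversion gives the coefficients: the kernel 1 + u t + d t^2 is
   (1 + t) (1 + y t) for descents and 1 + 2 t + y t^2 for peaks. For the total
   count (u = 2, d = 1) the series T = \sum_j x^j N^(j+1) satisfies
   N = x (1 + 2 T + x T) and T = N + x N T, which identify it with the Fine
   series. *)
Require Import Defs.
From mathcomp Require Import all_boot all_order all_algebra finmap.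
From mathcomp Require Import ring lra zify.
Import Order.TTheory GRing.Theory Num.Theory.
Local Open Scope ring_scope.

(** * Powers of the tree series *)

Section TreeSeries.

Variables (R : comNzRingType) (u d : R).

(* [treepow n k] is the coefficient of x^n in N^k, where N = x (1 + u N + d N^2). *)
Fixpoint treepow (n k : nat) : R :=
  match n, k with
  | 0, 0 => 1
  | n'.+1, k'.+1 => treepow n' k' + u * treepow n' k'.+1 + d * treepow n' k'.+2
  | _, _ => 0
  end.

Lemma treepow_small n k : (n < k)%N -> treepow n k = 0.
Proof.
elim: n k => [|n IH] [|k] //= lt_nk.
by rewrite !IH ?mulr0 ?addr0 // ltnW // ltnW.
Qed.

(** This is N^k N^l = N^(k+l), obtained without power series: for k > 0 the recursion unfolds the
    first factor, and all three resulting convolutions fall under the induction hypothesis. *)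
Lemma treepow_conv n k l :
  \sum_(i < n.+1) treepow i k * treepow (n - i)%N l = treepow n (k + l).
Proof.
elim: n k => [|n IH] k.
  by rewrite big_ord1; case: k l => [|k] [|l] //=; rewrite ?mulr0 ?mul0r ?mul1r.
rewrite big_ord_recl subn0; case: k => [|k].
  rewrite mul1r big1 ?addr0 // => i _; rewrite /= mul0r //.
rewrite mul0r add0r addSn /= -!addSn -!IH !mulr_sumr -!big_split /=.
by apply: eq_bigr => i _; rewrite subSS; ring.
Qed.

Lemma treepowSS n k :
  treepow n.+1 k.+1 = treepow n k + u * treepow n k.+1 + d * treepow n k.+2.
Proof. by []. Qed.

Lemma treepow0 k : treepow 0 k = (k == 0)%:R.
Proof. by case: k. Qed.

Lemma treepowS0 n : treepow n.+1 0 = 0.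
Proof. by []. Qed.

Lemma treepow1 k : treepow 1 k = (k == 1)%:R.
Proof. by case: k => [|[|k]] //=; rewrite !mulr0 !addr0. Qed.

Definition treekernel : {poly R} := 1 + u%:P * 'X + d%:P * 'X^2.

(** The coefficient of t^(n-k) in the n-th power of the kernel, the quantity on the kernel side of
    Lagrange inversion. Multiplying by ['X^k] instead of subtracting in the index makes it vanish
    for k > n. *)
Definition kernelpow n k := (treekernel ^+ n * 'X^k)`_n.

Lemma kernelpowS n k :
  kernelpow n.+1 k.+1 = kernelpow n k + u * kernelpow n k.+1 + d * kernelpow n k.+2.
Proof.
rewrite /kernelpow -!coefCM -!coefD.
have -> : treekernel ^+ n.+1 * 'X^(k.+1) = (treekernel ^+ n.+1 * 'X^k) * 'X.
  by rewrite -mulrA -exprSr.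
rewrite coefMX exprS {1}/treekernel /=; congr ((_ : {poly R})`_ _).
by rewrite !['X^(_.+1)]exprS; ring.
Qed.

(** Both sides are the coefficient of t^n in the derivative of [treekernel ^+ n.+1 * 'X^(k.+1)],
    read off directly on the left and through the product rule on the right. *)
Lemma kernelpow_deriv n k :
  n.+1%:R * kernelpow n.+1 k.+1 =
  n.+1%:R * (u * kernelpow n k.+1 + d * kernelpow n k.+2 *+ 2)
    + k.+1%:R * kernelpow n.+1 k.+1.
Proof.
have -> : n.+1%:R * kernelpow n.+1 k.+1 = ((treekernel ^+ n.+1 * 'X^(k.+1))^`())`_n.
  by rewrite coef_deriv mulr_natl.
have -> : (treekernel ^+ n.+1 * 'X^(k.+1))^`() =
    n.+1%:R%:P * (u%:P * (treekernel ^+ n * 'X^(k.+1))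
                  + d%:P * (treekernel ^+ n * 'X^(k.+2)) *+ 2)
    + k.+1%:R%:P * (treekernel ^+ n.+1 * 'X^k).
  rewrite derivM deriv_exp derivXn /= /treekernel !derivE /= !polyC_natr.
  by rewrite -mulr_natl -[X in _ + _ * X]mulr_natl !exprS; ring.
rewrite coefD !coefCM coefD coefMn !coefCM; congr (_ + _ * _).
by rewrite /kernelpow ['X^(k.+1)]exprSr mulrA coefMX.
Qed.

End TreeSeries.
Arguments treepow {R}.
Arguments treekernel {R}.
Arguments kernelpow {R}.

(** Lagrange inversion by induction on n. The tree recursion expresses the left side through three
    kernel coefficients at n; [kernelpowS] eliminates the one of index k, and [kernelpow_deriv]
    evaluates the combination of the other two that remains. *)
Lemma treepow_lagrange (u d : {poly rat}) n k :
  n%:R * treepow u d n k = k%:R * kernelpow u d n k.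
Proof.
elim: n k => [|n IH] [|k]; rewrite ?mul0r //.
- by rewrite /kernelpow expr0 mul1r coefXn mulr0.
- by rewrite /= mulr0.
(* At n = 0 the induction hypothesis is multiplied by zero and says nothing, so the coefficient of x
   is computed by hand. *)
case: n => [|n] in IH *.
  by rewrite kernelpowS /kernelpow expr0 !mul1r !coefXn; case: k => [|k] /=; ring.
apply: (@mulfI _ n.+1%:R); first by rewrite -polyC_natr polyC_eq0 pnatr_eq0.
have E0 := IH k; have E1 := IH k.+1; have E2 := IH k.+2.
have S := kernelpowS _ u d n.+1 k; have D := kernelpow_deriv _ u d n.+1 k.
set c := @kernelpow _ in E0 E1 E2 S D *.
transitivity (n.+2%:R * (n.+1%:R * treepow u d n.+1 k
  + u * (n.+1%:R * treepow u d n.+1 k.+1) + d * (n.+1%:R * treepow u d n.+1 k.+2))).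
  by rewrite -[treepow _ _ n.+2 _]/(treepow u d n.+1 k + u * treepow u d n.+1 k.+1
       + d * treepow u d n.+1 k.+2); ring.
rewrite E0 E1 E2.
have {}S : c u d n.+1 k = c u d n.+2 k.+1 - u * c u d n.+1 k.+1 - d * c u d n.+1 k.+2.
  by rewrite S; ring.
rewrite {}S.
transitivity (n.+2%:R * k%:R * c u d n.+2 k.+1
  + n.+2%:R * (u * c u d n.+1 k.+1 + d * c u d n.+1 k.+2 *+ 2)); first by ring.
have -> : n.+2%:R * (u * c u d n.+1 k.+1 + d * c u d n.+1 k.+2 *+ 2)
    = n.+2%:R * c u d n.+2 k.+1 - k.+1%:R * c u d n.+2 k.+1.
  by rewrite D; ring.
by ring.
Qed.

Arguments treepow : simpl never.

(** * Fibres of the stack-sorting map *)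

Lemma max_entry_mem x w : max_entry (x :: w) \in x :: w.
Proof.
rewrite /max_entry; elim: w x => [|y w IH] x; first by rewrite big_seq1 mem_head.
by rewrite big_cons; case: leqP => _; rewrite ?mem_head // in_cons IH orbT.
Qed.

(** The induction principle matching the recursion of [stack_sort]: the maximum of a word without
    repetitions splits it into two shorter words with strictly smaller entries. *)
Lemma word_ind_max (P : word -> Prop) :
    P [::] ->
    (forall L N R, all (ltn^~ N) L -> all (ltn^~ N) R ->
       P L -> P R -> P (L ++ N :: R)) ->
  forall w, uniq w -> P w.
Proof.
move=> P0 Pcat w; have [n] := ubnP (size w).
elim: n w => // n IH [|x w] // lt_w uniq_w.
have le_max y : y \in x :: w -> (y <= max_entry (x :: w))%N.
  by move=> y_in; apply: (@leq_bigmax_seq _ _ predT id).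
move: (max_entry (x :: w)) (max_entry_mem x w) le_max lt_w uniq_w => N.
case/splitPr=> L R le_max; rewrite size_cat /= cat_uniq /= addnS ltnS => lt_w.
case/and3P=> uL /norP[NL LR] /andP[NR uR].
apply: Pcat.
- apply/allP => y yL /=; rewrite ltn_neqAle le_max ?mem_cat ?yL // andbT.
  by apply: contraNneq NL => <-.
- apply/allP => y yR /=.
  rewrite ltn_neqAle le_max ?mem_cat ?in_cons ?yR ?orbT // andbT.
  by apply: contraNneq NR => <-.
- by apply: IH => //; apply: leq_ltn_trans (leq_addr _ _) lt_w.
- by apply: IH => //; apply: leq_ltn_trans (leq_addl _ _) lt_w.
Qed.

Lemma perm_stack_sort w : uniq w -> perm_eq (stack_sort w) w.
Proof.
elim/word_ind_max => // L N R hL hR pL pR.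
rewrite stack_sort_cat // perm_cat // -cat1s perm_catC.
by rewrite perm_cat2l.
Qed.

Definition fiber (t : word) : seq word :=
  [seq w <- permutations t | stack_sort w == t].

Lemma mem_fiber t w : uniq t -> (w \in fiber t) = uniq w && (stack_sort w == t).
Proof.
move=> ut; rewrite mem_filter mem_permutations andbC.
have [/eqP st|] := boolP (stack_sort w == t); last by rewrite !andbF.
rewrite !andbT; apply/idP/idP => [/perm_uniq->//|/perm_stack_sort].
by rewrite st perm_sym.
Qed.

Lemma fiber_uniq t : uniq (fiber t).
Proof. by rewrite filter_uniq ?permutations_uniq. Qed.

(** Sorting ends with the maximum, so N must be the maximum of w; the sorted sides are then a prefix
    and the complementary suffix of t, cut at the length of the left side. *)
Lemma fiberP_rcons t N w : uniq (rcons t N) -> w \in fiber (rcons t N) ->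
  exists L R, [/\ w = L ++ N :: R, L \in fiber (take (size L) t),
    R \in fiber (drop (size L) t), all (ltn^~ N) t & (size L <= size t)%N].
Proof.
move=> ut; rewrite mem_fiber // => /andP[uw].
elim/word_ind_max: w / uw (uw) => [_|L M R hL hR _ _ uw]; first by case: t {ut}.
rewrite stack_sort_cat // catA cats1 eqseq_rcons => /andP[/eqP st /eqP eM].
move: uw ut; rewrite {M}eM in hL hR *.
rewrite cat_uniq /= rcons_uniq => /and3P[uL _ /andP[_ uR]] /andP[_ ut].
have pL := perm_stack_sort _ uL; have pR := perm_stack_sort _ uR.
have sL := perm_size pL.
have eL : take (size L) t = stack_sort L by rewrite -st take_size_cat.
have eR : drop (size L) t = stack_sort R by rewrite -st drop_size_cat.
exists L, R; split=> //.
- by rewrite mem_fiber ?take_uniq // uL eL eqxx.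
- by rewrite mem_fiber ?drop_uniq // uR eR eqxx.
- by rewrite -st all_cat (perm_all _ pL) hL (perm_all _ pR).
- by rewrite -st size_cat sL leq_addr.
Qed.

Section FiberWeight.

Variables (R : comNzRingType) (wt : word -> R) (e : bool -> bool -> R).
Hypothesis wt_nil : wt [::] = 1.
Hypothesis wt_cat : forall L N M, all (ltn^~ N) L -> all (ltn^~ N) M ->
  wt (L ++ N :: M) = e (L != [::]) (M != [::]) * wt L * wt M.
Hypothesis e00 : e false false = 1.

Definition fiberwt (t : word) : R := \sum_(w <- fiber t) wt w.

Lemma fiberwt_nil : fiberwt [::] = 1.
Proof. by rewrite /fiberwt (_ : fiber [::] = [:: [::]]) // big_seq1. Qed.

Lemma fiberwt_not_max t N : uniq (rcons t N) -> ~~ all (ltn^~ N) t ->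
  fiberwt (rcons t N) = 0.
Proof.
move=> ut /negP nt; rewrite /fiberwt big_seq big1 // => w.
by case/fiberP_rcons=> // L [M [_ _ _ /nt]].
Qed.

Lemma fiberwt_rcons t N : uniq (rcons t N) -> all (ltn^~ N) t ->
  fiberwt (rcons t N) = \sum_(i < (size t).+1)
    e (i != 0%N :> nat) (i != size t :> nat) * fiberwt (take i t) * fiberwt (drop i t).
Proof.
move=> ut hN.
have Nt : N \notin t by move: ut; rewrite rcons_uniq => /andP[].
have ut' : uniq t by move: ut; rewrite rcons_uniq => /andP[].
have allTD i : all (ltn^~ N) (take i t) && all (ltn^~ N) (drop i t).
  by rewrite -all_cat cat_take_drop.
have indexN L M : all (ltn^~ N) L -> index N (L ++ N :: M) = size L.
  move=> hL; rewrite index_cat /= eqxx addn0 ifN //.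
  by apply/negP => /(allP hL) /=; rewrite ltnn.
have allL s L : L \in fiber s -> all (ltn^~ N) s -> all (ltn^~ N) L.
  by rewrite mem_filter mem_permutations => /andP[_ /perm_all->].
rewrite /fiberwt.
(* The fibre is classified by the position i of N; each class is the product of the fibres over
   [take i t] and [drop i t]. *)
transitivity (\sum_(w <- fiber (rcons t N)) \sum_(i < (size t).+1 | index N w == i) wt w).
  rewrite big_seq [RHS]big_seq; apply: eq_bigr => w /fiberP_rcons[] // L [M [-> hL _ _ szL]].
  rewrite indexN; last by apply: (allL _ _ hL); case/andP: (allTD (size L)).
  by rewrite -ltnS in szL; rewrite (big_pred1 (Ordinal szL)).
rewrite (exchange_big_dep predT) //=; apply: eq_bigr => i _.
have le_it : (i <= size t)%N by rewrite -ltnS.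
have /andP[hNt hNd] := allTD i.
rewrite -mulrA big_distrlr /= mulr_sumr -big_filter.
rewrite (perm_big [seq L ++ N :: M | L <- fiber (take i t), M <- fiber (drop i t)]).
  rewrite big_allpairs_dep /= big_seq [RHS]big_seq; apply: eq_bigr => L hL.
  rewrite mulr_sumr big_seq [RHS]big_seq; apply: eq_bigr => M hM.
  rewrite wt_cat ?(allL _ _ hL) ?(allL _ _ hM) // mulrA; congr (e _ _ * _ * _).
    move: hL; rewrite mem_filter mem_permutations => /andP[_ /perm_size sL].
    by rewrite -size_eq0 sL size_takel.
  move: hM; rewrite mem_filter mem_permutations => /andP[_ /perm_size sM].
  by rewrite -size_eq0 sM size_drop subn_eq0 -ltnNge ltn_neqAle le_it andbT.
apply: uniq_perm; first by rewrite filter_uniq ?fiber_uniq.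
  apply: allpairs_uniq; rewrite ?fiber_uniq // => -[L M] [L' M'].
  case/allpairsP=> -[a b] /= [ha _ [-> _]] /allpairsP[[a' b'] /= [ha' _ [-> _]]].
  move/eqP; rewrite eqseq_cat; first by case/andP=> /eqP-> /eqP[->].
  move: ha ha'; rewrite !mem_filter !mem_permutations.
  by case/andP=> _ /perm_size-> /andP[_ /perm_size->].
move=> w; rewrite mem_filter; apply/andP/allpairsP => [[/eqP iw]|].
  case/fiberP_rcons=> // L [M [ew hL hM _ szL]]; exists (L, M) => /=.
  move: iw; rewrite ew indexN; last by apply: (allL _ _ hL); case/andP: (allTD (size L)).
  by move=> iL; rewrite iL in hL hM.
case=> -[L M] /= [hL hM ->].
have {}hNt := allL _ _ hL hNt; have {}hNd := allL _ _ hM hNd.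
move: (hL) (hM); rewrite !mem_fiber ?take_uniq ?drop_uniq //.
case/andP=> uL /eqP sL /andP[uM /eqP sM].
have pL := perm_stack_sort _ uL.
rewrite indexN // -(perm_size pL) sL size_takel // eqxx; split=> //.
rewrite stack_sort_cat // sL sM catA cat_take_drop cats1 eqxx andbT.
have /perm_uniq-> // : perm_eq (L ++ N :: M) (rcons t N).
rewrite -(cat_take_drop i t) -cats1 -catA -sL -sM.
rewrite perm_cat // 1?perm_sym // -[N :: M]cat1s perm_catC perm_cat2l.
by rewrite perm_stack_sort.
Qed.

(** Arbitrary increasing words replace intervals because cutting a hook leaves pieces that need not
    start at 1. The cuts of the word before its maximum reproduce, term by term, the recursion
    [treepowSS]. *)
Lemma fiberwt_hook s v j : sorted ltn (s ++ v) -> size s = j.+1 ->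
  fiberwt (rev s ++ v) =
    e true true ^+ j * treepow (e true false + e false true) (e true true)
                         (size v).+1 j.+1.
Proof.
have [n] := ubnP (size (s ++ v)); elim: n s v j => // n IH s v j.
set d := e true true; set b := treepow _ _ in IH *.
have sorted_uniq2 a : sorted ltn a -> uniq a.
  by apply: sorted_uniq; [exact: ltn_trans | exact: ltnn].
(* With v empty the word is decreasing, and its last entry is the maximum only if j = 0; this
   matches [treepow1]. *)
case/lastP: v => [|v N].
  rewrite !cats0 /=; case: s => // x s _ hs [<-] {j}.
  rewrite rev_cons; case: s => [|y s] in hs *.
    by rewrite fiberwt_rcons // big_ord1 /= e00 !fiberwt_nil /b treepow1 !mulr1.
  rewrite fiberwt_not_max.
  - by rewrite /b treepow1 mulr0.
  - by rewrite -rev_cons rev_uniq sorted_uniq2.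
  - apply/negP => /allP /(_ y); rewrite mem_rev mem_head => /(_ isT) /=.
    by move: hs => /= /andP[/ltnW]; rewrite leqNgt => /negbTE->.
rewrite -!rcons_cat !size_rcons ltnS => szn hs szs.
rewrite size_cat szs in szn.
have hN : all (ltn^~ N) (s ++ v).
  move: hs; rewrite -(rev_sorted (fun x y => (y < x)%N)) rev_rcons /=.
  rewrite path_sortedE; last by move=> x y z h1 h2; apply: ltn_trans h2 h1.
  by rewrite all_rev => /andP[].
have hsv : sorted ltn (s ++ v).
  by move: hs; rewrite -cats1 => /(subseq_sorted ltn_trans); apply; apply: prefix_subseq.
have sub a : subseq a (s ++ v) -> sorted ltn a.
  by move=> h; apply: (subseq_sorted ltn_trans h).
rewrite fiberwt_rcons; last 2 first.
- by move: (sorted_uniq2 _ hs);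
    rewrite !rcons_uniq !mem_cat !cat_uniq mem_rev rev_uniq (eq_has (mem_rev s)).
- by move: hN; rewrite !all_cat all_rev.
set t := rev s ++ v.
have szt : size t = (j + size v).+1 by rewrite size_cat size_rev szs.
have Wt : fiberwt t = d ^+ j * b (size v).+1 j.+1 by apply: IH; rewrite // size_cat szs.
(* The first and last cuts leave one side empty and together give the u-term of the recursion. *)
rewrite szt big_ord_recl big_ord_recr /= take0 drop0 fiberwt_nil mulr1.
rewrite [bump 0 (j + size v)]add1n -szt take_size drop_size fiberwt_nil.
rewrite mulr1 eqxx szt /= Wt.
have -> : \sum_(i < j + size v) e (bump 0 i != 0)%N (bump 0 i != (j + size v).+1)
    * fiberwt (take (bump 0 i) t) * fiberwt (drop (bump 0 i) t) =
  \sum_(i < j + size v) d * (fiberwt (take i.+1 t) * fiberwt (drop i.+1 t)).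
  apply: eq_bigr => i _; rewrite /bump /= add1n mulrA; congr (e _ _ * _ * _).
  by rewrite eqSS neq_ltn ltn_ord.
rewrite big_split_ord /=.
(* A cut inside the decreasing part leaves a decreasing prefix, of weight zero unless it is a single
   entry. The one surviving cut removes the largest entry of s, which lowers j by one. *)
have -> : \sum_(i < j) d * (fiberwt (take i.+1 t) * fiberwt (drop i.+1 t)) =
    d ^+ j * b (size v).+1 j.
  case: j => [|j] in szs szn hs {szt Wt} *; first by rewrite big_ord0 /b treepowS0 mulr0.
  have takeW (i : 'I_j.+1) : fiberwt (take i.+1 t) = d ^+ i * b 1%N i.+1.
    rewrite /t take_cat size_rev szs ltnS ltn_ord take_rev -[rev _]cats0.
    apply: IH; rewrite ?cats0.
    - by rewrite size_drop; lia.
    - apply: sub; apply: subseq_trans (drop_subseq _ _) _; exact: prefix_subseq.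
    - by rewrite size_drop szs; have := ltn_ord i; lia.
  rewrite big_ord_recl big1 ?addr0; last first.
    by move=> i _; rewrite takeW /b treepow1 !mulr0 mul0r mulr0.
  rewrite takeW expr0 mul1r /b treepow1 mul1r.
  rewrite /t drop_cat size_rev szs /= drop_rev szs subn1 /=.
  rewrite (IH _ _ j) ?mulrA -?exprS //.
  - by rewrite size_cat size_takel ?szs //; lia.
  - apply: sub; apply: cat_subseq => //; exact: take_subseq.
  - by rewrite size_takel ?szs.
(* A cut inside v, or just before it, leaves a hook and a nonempty increasing word, hence the
   convolution N^(j+1) N = N^(j+2). Its two extreme terms vanish since N has no constant term. *)
have -> : \sum_(i < size v) d * (fiberwt (take (j + i).+1 t) * fiberwt (drop (j + i).+1 t)) =
    d ^+ j * (d * b (size v).+1 j.+2).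
  rewrite -[j.+2]addn1 /b -treepow_conv big_ord_recl big_ord_recr /= mul0r add0r.
  rewrite subnn /= mulr0 addr0 !mulr_sumr; apply: eq_bigr => i _.
  have -> : take (j + i).+1 t = rev s ++ take i v.
    by rewrite /t -addSn -szs -(size_rev s) takeD take_size_cat // drop_size_cat.
  have -> : drop (j + i).+1 t = drop i v.
    by rewrite /t -addSn -szs -(size_rev s) addnC -drop_drop drop_size_cat.
  rewrite (IH _ _ j) //; last 2 first.
  - by rewrite size_cat szs size_take_min; lia.
  - by apply: sub; apply: cat_subseq => //; exact: take_subseq.
  (* An increasing word is the case j = 0, with its first entry as the decreasing part. *)
  rewrite (drop_nth 0%N) // -[_ :: _]/(rev [:: nth 0%N v i] ++ drop i.+1 v).
  rewrite (IH _ _ 0%N) //; last 2 first.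
  - by rewrite /= size_drop; lia.
  - rewrite cat1s -drop_nth //; apply: sub.
    apply: subseq_trans (drop_subseq _ _) _; exact: suffix_subseq.
  rewrite size_takel ?size_drop; last exact/ltnW.
  rewrite expr0 mul1r /bump /= add1n subSS -subSn // subSS /b; ring.
by rewrite /b [in RHS]treepowSS -/d; ring.
Qed.

End FiberWeight.

(** * Permutations avoiding 132, 231 and 312 *)

Definition hook (n h : nat) : word := rev (iota 1 h) ++ iota h.+1 (n - h).

(** The strict order h, h - 1, ..., 0, h + 1, h + 2, ..., for which [hook n h] is sorted; equality
    with a hook thus reduces to uniqueness of sorted words. *)
Definition hookrel (h x y : nat) : bool :=
  if (y <= h)%N then (y < x <= h)%N else (x < y)%N.

Lemma hookrel_irr h : irreflexive (hookrel h).
Proof. by move=> x; rewrite /hookrel ltnn; case: ifP. Qed.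

Lemma hookrel_trans h : transitive (hookrel h).
Proof. by move=> y x z; rewrite /hookrel; do !case: ifP; lia. Qed.

Lemma hook_pairwise n h : pairwise (hookrel h) (hook n h).
Proof.
rewrite pairwise_cat; apply/and3P; split.
- apply/allrelP => x y; rewrite mem_rev !mem_iota /hookrel.
  by case: ifP; lia.
- apply: (@sub_in_pairwise _ (gtn h.+1) (fun x y => (y < x)%N)).
  + by move=> x y; rewrite !inE /hookrel; case: ifP; lia.
  + by apply/allP => x; rewrite mem_rev mem_iota inE; lia.
  + rewrite -sorted_pairwise ?rev_sorted ?iota_ltn_sorted //.
    by move=> x y z; lia.
- apply: (@sub_in_pairwise _ (ltn h) ltn).
  + by move=> x y; rewrite !inE /hookrel; case: ifP; lia.
  + by apply/allP => x; rewrite mem_iota inE; lia.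
  + by rewrite -sorted_pairwise ?iota_ltn_sorted //; apply: ltn_trans.
Qed.

Lemma perm_hook n h : (h <= n)%N -> perm_eq (hook n h) (iota 1 n).
Proof.
move=> le_hn; rewrite -[n in iota 1 n](subnKC le_hn) iotaD add1n.
by rewrite perm_cat2r perm_rev.
Qed.

Lemma head_hook n h : (0 < h)%N -> head 0%N (hook n h) = h.
Proof.
by case: h => // h _; rewrite /hook -[h.+1]addn1 iotaD rev_cat /= add1n addn1.
Qed.

Lemma order_iso3 u p q r : order_iso u [:: p; q; r] ->
  exists x y z, u = [:: x; y; z] /\
   [&& (x < y) == (p < q), (y < x) == (q < p), (x < z) == (p < r),
       (z < x) == (r < p), (y < z) == (q < r) & (z < y) == (r < q)]%N.
Proof.
case: u => [|x [|y [|z [|]]]] //; rewrite /order_iso /= => /forallP iso.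
exists x, y, z; split=> //.
have at_ (i j : 'I_3) := forallP (iso i) j.
pose o0 : 'I_3 := @Ordinal 3 0 isT; pose o1 : 'I_3 := @Ordinal 3 1 isT.
pose o2 : 'I_3 := @Ordinal 3 2 isT.
by rewrite (at_ o0 o1) (at_ o1 o0) (at_ o0 o2) (at_ o2 o0) (at_ o1 o2) (at_ o2 o1).
Qed.

Lemma contains3 w x y z p q r : subseq [:: x; y; z] w ->
   [&& (x < y) == (p < q), (y < x) == (q < p), (x < z) == (p < r),
       (z < x) == (r < p), (y < z) == (q < r) & (z < y) == (r < q)]%N ->
  contains w [:: p; q; r].
Proof.
move=> sub /and5P[h1 h2 h3 h4 /andP[h5 h6]]; apply/containsP; exists [:: x; y; z] => //.
rewrite /order_iso /=; apply/forallP => -[[|[|[|]]] //= _];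
  by apply/forallP => -[[|[|[|]]] //= _]; rewrite ?ltnn.
Qed.

Lemma pairwise_of_subseq (T : eqType) (r : rel T) s :
  (forall x y, subseq [:: x; y] s -> r x y) -> pairwise r s.
Proof.
elim: s => //= x s IH h; rewrite IH; last first.
  by move=> y z yz; apply: h; apply: subseq_trans yz (subseq_cons _ _).
by rewrite andbT; apply/allP => y ys; apply: h; rewrite eqxx sub1seq.
Qed.

Definition hook_patterns : seq word :=
  [:: [:: 1; 3; 2]; [:: 2; 3; 1]; [:: 3; 1; 2]]%N.

(** Let h be the first entry. If x precedes y later in the word against the hook order, then h, x, y
    form 312 when x < y < h, 231 when y < h < x, and 132 when h < y < x. Conversely, none of the
    three patterns is compatible with the hook order. *)
Lemma avoid_hook n v : (0 < n)%N -> perm_eq v (iota 1 n) ->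
  all (fun tau => ~~ contains v tau) hook_patterns = (v == hook n (head 0%N v)).
Proof.
move=> n0 pv; have uv : uniq v by rewrite (perm_uniq pv) iota_uniq.
have v_range x : (x \in v) = (1 <= x < 1 + n)%N by rewrite (perm_mem pv) mem_iota.
apply/idP/eqP => [|->]; last first.
  apply/allP => tau; rewrite !inE => /or3P[] /eqP ->;
  apply/containsP => -[u /subseq_pairwise/(_ (hook_pairwise _ _)) pu];
  case/order_iso3=> x [y [z [eu /and5P[? ? ? ? /andP[]]]]]; move: pu; rewrite {u}eu /= !andbT;
  by case/andP=> /andP[]; rewrite /hookrel; do !case: ifP; lia.
case: v => [|h v] in pv uv v_range *; first by move: (perm_size pv) n0; rewrite size_iota /= => <-.
move=> /and4P[n132 n231 n312 _] /=.
have h_range : (1 <= h <= n)%N by have := v_range h; rewrite mem_head add1n ltnS.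
apply: (irr_sorted_eq (@hookrel_trans h) (@hookrel_irr h)).
- rewrite sorted_pairwise; last exact: hookrel_trans.
  have neq_h y : y \in v -> y != h by move=> yv; apply: contraTneq yv => ->; case/andP: uv.
  rewrite pairwise_cons; apply/andP; split.
    by apply/allP => y /neq_h; rewrite /hookrel; case: ifP; lia.
  apply: pairwise_of_subseq => x y sub.
  have /neq_h hx : x \in v by apply: (mem_subseq sub); rewrite mem_head.
  have /neq_h hy : y \in v by apply: (mem_subseq sub); rewrite !inE eqxx orbT.
  have nxy : x != y by have := subseq_uniq sub; case/andP: uv => _ uv /(_ uv) /=; rewrite inE andbT.
  have sub' : subseq [:: h; x; y] (h :: v) by rewrite /= eqxx.
  rewrite /hookrel; apply: contraNT n132 => nr.
  case: (ltnP y h) nr => [yh|hy'].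
    rewrite (ltnW yh) => nr.
    have [xh|hx'] := ltnP x h.
      by case/negP: n312; apply: (contains3 _ _ _ _ _ _ _ sub'); lia.
    by case/negP: n231; apply: (contains3 _ _ _ _ _ _ _ sub'); lia.
  rewrite ifN; last by lia.
  by move=> nr; apply: (contains3 _ _ _ _ _ _ _ sub'); lia.
- by rewrite sorted_pairwise ?hook_pairwise //; apply: hookrel_trans.
- move=> x; rewrite v_range (perm_mem (perm_hook _ _ _)) ?mem_iota //.
  by case/andP: h_range.
Qed.

(** The preimage is the disjoint union of the fibres over the n hooks, which are told apart by their
    first entries. *)
Lemma sum_stack_preim (R : comNzRingType) (wt : word -> R) n : (0 < n)%N ->
  \sum_(w <- stack_preim n (Av n hook_patterns)) wt w =
  \sum_(h < n) fiberwt _ wt (hook n h.+1).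
Proof.
move=> n0; set P := stack_preim _ _.
have mem_P w : (w \in P) = perm_eq w (iota 1 n) &&
    all (fun tau => ~~ contains (stack_sort w) tau) hook_patterns.
  rewrite !inE !mem_permutations; apply: andb_id2l => pw.
  have uw : uniq w by rewrite (perm_uniq pw) iota_uniq.
  by rewrite (permPl (perm_stack_sort _ uw)) pw.
have memP_hook w (h : 'I_n) : stack_sort w = hook n h.+1 -> (w \in P) = uniq w.
  move=> sw; rewrite mem_P; apply/andP/idP => [[/perm_uniq->]|uw].
    by rewrite iota_uniq.
  have ph : perm_eq (stack_sort w) (iota 1 n) by rewrite sw perm_hook.
  rewrite -(permPl (perm_stack_sort _ uw)); split=> //.
  by rewrite (avoid_hook _ _ n0) // sw head_hook.
transitivity (\sum_(w <- P) \sum_(h < n | stack_sort w == hook n h.+1) wt w).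
  rewrite big_seq [RHS]big_seq; apply: eq_bigr => w; rewrite mem_P => /andP[pw].
  have uw : uniq w by rewrite (perm_uniq pw) iota_uniq.
  have ps : perm_eq (stack_sort w) (iota 1 n) by rewrite (permPl (perm_stack_sort _ uw)).
  rewrite (avoid_hook _ _ n0) // => /eqP eh.
  have : head 0%N (stack_sort w) \in iota 1 n.
    rewrite -(perm_mem ps) -nth0 mem_nth // (perm_size ps) size_iota //.
  rewrite mem_iota => /andP[h0 hn]; set h := head _ _ in eh h0 hn.
  have h_lt : (h.-1 < n)%N by lia.
  rewrite (big_pred1 (Ordinal h_lt)) // => i /=.
  rewrite eh -val_eqE /=; apply/eqP/eqP => [/(congr1 (head 0%N))|->].
    by rewrite !head_hook // => ->.
  by rewrite prednK.
rewrite (exchange_big_dep predT) //=; apply: eq_bigr => h _.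
rewrite -big_filter; apply: perm_big; apply: uniq_perm.
- by rewrite filter_uniq ?fset_uniq.
- exact: fiber_uniq.
move=> w; have uh : uniq (hook n h.+1) by rewrite (perm_uniq (perm_hook _ _ _)) ?iota_uniq.
rewrite mem_filter mem_fiber // andbC; apply: andb_id2r => /eqP sw.
exact: memP_hook sw.
Qed.

(** * Descents and peaks *)

Lemma size_descents2 x y w :
  size (descents (x :: y :: w)) = ((y < x) + size (descents (y :: w)))%N.
Proof.
rewrite /descents /= !subn1 /= -[in iota 2 _](add1n 1) iotaDl filter_map.
rewrite [(entry _ 2 < _)%N]/(y < x)%N.
have -> : [seq i <- iota 1 (size w) | preim (addn 1) (fun i =>
      entry [:: x, y & w] i.+1 < entry [:: x, y & w] i)%N i] =
    [seq i <- iota 1 (size w) | (entry (y :: w) i.+1 < entry (y :: w) i)%N].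
  by apply: eq_in_filter => -[|i]; rewrite ?mem_iota.
by case: ifP; rewrite /= size_map.
Qed.

Lemma size_descents_cat L N M : all (ltn^~ N) L -> all (ltn^~ N) M ->
  size (descents (L ++ N :: M)) =
  ((M != [::]) + size (descents L) + size (descents M))%N.
Proof.
move=> hL hM; elim: L hL => [_|x [|y L] IH /= /andP[hx hL]].
- case: M hM => [|y M] //= /andP[hy _].
  by rewrite size_descents2 hy.
- by rewrite size_descents2 IH // ltnNge (ltnW hx).
- by rewrite !size_descents2 -cat_cons IH // -!addnA addnCA.
Qed.

Lemma size_peaks3 x y z w :
  size (peaks (x :: y :: z :: w)) =
  ((x < y) && (z < y) + size (peaks (y :: z :: w)))%N.
Proof.
rewrite /peaks /= !subn2 /= -[in iota 3 _](add1n 2) iotaDl filter_map.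
rewrite [(entry _ 1 < _)%N]/(x < y)%N [(entry _ 3 < _)%N]/(z < y)%N.
have -> : [seq i <- iota 2 (size w) | preim (addn 1) (fun i =>
      (entry [:: x, y, z & w] i.-1 < entry [:: x, y, z & w] i) &&
      (entry [:: x, y, z & w] i.+1 < entry [:: x, y, z & w] i))%N i] =
    [seq i <- iota 2 (size w) | (entry [:: y, z & w] i.-1 < entry [:: y, z & w] i)%N &&
      (entry [:: y, z & w] i.+1 < entry [:: y, z & w] i)%N].
  by apply: eq_in_filter => -[|[|i]]; rewrite ?mem_iota.
by case: ifP; rewrite /= size_map.
Qed.

(** The neighbours of N in the word are smaller than N, so they are not peaks; being end entries of
    L and M, they are not peaks there either. Only N itself can be a new peak. *)
Lemma size_peaks_cat L N M : all (ltn^~ N) L -> all (ltn^~ N) M ->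
  size (peaks (L ++ N :: M)) =
  ((L != [::]) && (M != [::]) + size (peaks L) + size (peaks M))%N.
Proof.
move=> hL hM; have peaksN : size (peaks (N :: M)) = size (peaks M).
  case: M hM => [|y [|z M]] //= /andP[hy _].
  by rewrite size_peaks3 ltnNge (ltnW hy).
elim: L hL => [_|x [|y L] IH /= /andP[hx hL]]; first by rewrite /= peaksN.
- case: M hM peaksN {IH} => [|z M] //= /andP[hz _] peaksN.
  by rewrite size_peaks3 hx hz peaksN.
- case: L hL IH => [|z L] hL IH.
    rewrite /= size_peaks3 IH // [(N < y)%N]ltnNge.
    by move: hL => /= /andP[/ltnW->]; rewrite andbF.
  by rewrite /= !size_peaks3 -!cat_cons IH // -!addnA addnCA.
Qed.

Lemma sum_preim_treepow (R : comNzRingType) (wt : word -> R)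
    (e : bool -> bool -> R) n : (0 < n)%N ->
    wt [::] = 1 -> e false false = 1 ->
    (forall L N M, all (ltn^~ N) L -> all (ltn^~ N) M ->
      wt (L ++ N :: M) = e (L != [::]) (M != [::]) * wt L * wt M) ->
  \sum_(w <- stack_preim n (Av n hook_patterns)) wt w =
  \sum_(h < n) e true true ^+ h *
    treepow (e true false + e false true) (e true true) (n - h) h.+1.
Proof.
move=> n0 wt0 e0 wtM; rewrite sum_stack_preim //; apply: eq_bigr => h _.
have lt_hn := ltn_ord h.
rewrite (fiberwt_hook _ _ _ wt0 wtM e0 _ _ h) ?size_iota //.
  by rewrite subnSK.
by rewrite -[h.+2]/(1 + h.+1)%N -iotaD iota_ltn_sorted.
Qed.

Lemma card_stat (P : {fset word}) (f : word -> nat) m :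
  #|` [fset w in P | f w == m]%fset|%:R = (\sum_(w <- P) 'X^(f w) : {poly rat})`_m.
Proof.
rewrite coef_sum (eq_bigr (fun w => (f w == m)%:R)); last first.
  by move=> w _; rewrite coefXn eq_sym.
rewrite -natr_sum -big_mkcond sum1_count -size_filter; congr _%:R.
apply/perm_size/uniq_perm; rewrite ?fset_uniq ?filter_uniq ?fset_uniq // => w.
by rewrite mem_filter !inE andbC.
Qed.

(** * Coefficients of the tree powers for the descent and peak kernels *)

Lemma treepow_coef (u d : {poly rat}) n k e : (0 < n)%N ->
  (treepow u d n k)`_e = k%:R / n%:R * (kernelpow u d n k)`_e.
Proof.
move=> n0; have /(congr1 (fun p : {poly rat} => p`_e)) := treepow_lagrange u d n k.
rewrite /= -!polyC_natr !coefCM => eq_nk.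
by rewrite mulrAC -eq_nk mulrC mulKf // pnatr_eq0 -lt0n.
Qed.

Lemma coef_exp1aX (R : comNzRingType) (a : R) n i :
  ((1 + a%:P * 'X) ^+ n)`_i = a ^+ i *+ 'C(n, i).
Proof.
elim: n i => [|n IH] i.
  by rewrite expr0 coef1 bin0n; case: i => [|i]; rewrite ?mulr0n.
rewrite exprS mulrDl mul1r coefD -mulrA coefCM coefXM IH.
case: i => [|i] /=; first by rewrite mulr0 addr0 !bin0.
by rewrite IH binS mulrnDr exprS mulrnAr.
Qed.

(** The outer variable is t and the inner one marks descents. In the factorization (1 + y t)(1 + t),
    the power y^e forces t^e from the first factor, which leaves t^(n-k-e) for the second. *)
Lemma kernelpow_des n k e :
  (kernelpow (1 + 'X) 'X n k)`_e = ('C(n, e) * 'C(n, k + e))%:R :> rat.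
Proof.
rewrite /kernelpow coefMXn; case: ltnP => [nk|kn].
  by rewrite coef0 [X in (_ * X)%N]bin_small ?muln0 // ltn_addr.
have -> : treekernel (1 + 'X) 'X = (1 + 'X%:P * 'X) * (1 + 1%:P * 'X) :> {poly {poly rat}}.
  by rewrite /treekernel polyCD; ring.
rewrite exprMn coefM coef_sum.
have term (l : 'I_(n - k).+1) :
   (((1 + 'X%:P * 'X) ^+ n)`_l * ((1 + 1%:P * 'X) ^+ n)`_(n - k - l))`_e =
   if e == l then ('C(n, l) * 'C(n, n - k - l))%:R else 0 :> rat.
  rewrite !coef_exp1aX expr1n mulrnAr mulr1 -mulrnA coefMn coefXn.
  by case: eqP => _; rewrite /= ?mul0rn.
under eq_bigr do rewrite term; rewrite -big_mkcond /=.
have [le_e|lt_e] := ltnP e (n - k).+1.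
  rewrite (big_pred1 (Ordinal le_e)) /=; last by move=> l; rewrite eq_sym.
  by rewrite -subnDA bin_sub //; lia.
rewrite big_pred0 => [|l].
  by rewrite [X in (_ * X)%N]bin_small ?muln0 //; lia.
by apply/eqP => el; move: lt_e; rewrite el ltnNge -ltnS ltn_ord.
Qed.

(** In the binomial expansion of ((1 + 2 t) + y t^2)^n only the e-th term carries y^e. Whenever the
    exponent of 2 is truncated, one of the binomial coefficients is zero. *)
Lemma kernelpow_peak n k e :
  (kernelpow 2%:R 'X n k)`_e =
  (2 ^ (n - k - e.*2) * 'C(n, e) * 'C(n - e, k + e))%:R :> rat.
Proof.
rewrite /kernelpow.
have -> : treekernel 2%:R 'X = (1 + 2%:R%:P * 'X) + 'X%:P * 'X^2 :> {poly {poly rat}}.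
  by rewrite /treekernel; ring.
rewrite exprDn mulr_suml !coef_sum.
have term (l : 'I_n.+1) :
  (((1 + 2%:R%:P * 'X) ^+ (n - l) * ('X%:P * 'X^2) ^+ l *+ 'C(n, l) * 'X^k)`_n)`_e =
  if e == l then (2 ^ (n - k - l.*2) * 'C(n, l) * 'C(n - l, k + l))%:R else 0 :> rat.
  have -> : (1 + 2%:R%:P * 'X) ^+ (n - l) * ('X%:P * 'X^2) ^+ l *+ 'C(n, l) * 'X^k =
     ('X^l)%:P * ((1 + 2%:R%:P * 'X) ^+ (n - l) * 'X^(k + l.*2)) *+ 'C(n, l)
     :> {poly {poly rat}}.
    rewrite exprMn -exprM mul2n exprD polyC_exp.
    by move: (_ ^+ (n - l)) (_ ^+ l) 'X^k 'X^(l.*2) => A B C D; ring.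
  rewrite !coefMn coefCM coefMXn; have le_ln := ltn_ord l; case: ltnP => [lt_n|le_n].
    rewrite mulr0 coef0 mul0rn; case: eqP => // _.
    by rewrite [X in (_ * X)%N]bin_small ?muln0 //; lia.
  rewrite coef_exp1aX -natrX mulrnAr mulr_natr -mulrnA coefMn coefXn.
  case: eqP => [_|_]; last by rewrite !mul0rn.
  rewrite -mulrnA -subnDA; congr _%:R.
  have -> : 'C(n - l, n - (k + l.*2)) = 'C(n - l, k + l).
    by rewrite -bin_sub; [congr 'C(_, _) | ]; lia.
  by rewrite mulnAC.
under eq_bigr do rewrite term; rewrite -big_mkcond /=.
have [le_e|lt_e] := ltnP e n.+1.
  by rewrite (big_pred1 (Ordinal le_e)) //= => l; rewrite eq_sym.
rewrite big_pred0 => [|l]; first by rewrite [X in (_ * X * _)%N]bin_small ?muln0.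
by apply/eqP => el; move: lt_e; rewrite el ltnNge -ltnS ltn_ord.
Qed.

(** * Fine numbers *)

Lemma fps_sqr_inj (f g : fps) : f 0%N = 1 -> g 0%N = 1 ->
  fps_mul f f =1 fps_mul g g -> f =1 g.
Proof.
move=> f0 g0 fg; elim/ltn_ind => -[|n] IH; first by rewrite f0 g0.
have := fg n.+1; rewrite /fps_mul big_ord_recl big_ord_recr [RHS]big_ord_recl [in RHS]big_ord_recr /=.
rewrite !subn0 [bump 0 n]add1n subnn f0 g0 !mul1r !mulr1.
have -> : \sum_(i < n) f (bump 0 i) * f (n.+1 - bump 0 i)%N =
          \sum_(i < n) g (bump 0 i) * g (n.+1 - bump 0 i)%N.
  by apply: eq_bigr => i _; have lt_in := ltn_ord i;
    rewrite [bump 0 i]add1n subSS !IH //; lia.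
by lra.
Qed.

Lemma fps_mul_inj (b f g : fps) : b 0%N != 0 ->
  fps_mul f b =1 fps_mul g b -> f =1 g.
Proof.
move=> b0 fg; elim/ltn_ind => n IH.
have := fg n; rewrite /fps_mul !big_ord_recr /= subnn.
rewrite (eq_bigr (fun i : 'I_n => g i * b (n - i)%N)) => [/addrI|i _].
  exact: mulIf.
by rewrite IH.
Qed.

Section Fine.

Variable b : nat -> nat -> rat.
Hypothesis b0 : forall k, b 0%N k = (k == 0%N)%:R.
Hypothesis bS0 : forall n, b n.+1 0%N = 0.
Hypothesis bS : forall n k, b n.+1 k.+1 = b n k + 2%:R * b n k.+1 + b n k.+2.
Hypothesis b_conv : forall n k l,
  \sum_(i < n.+1) b i k * b (n - i)%N l = b n (k + l).

(* T = \sum_j x^j N^(j+1), C = 1 + N and, below, sqrt (1 - 4 x) = 1 - 2 x C and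
   the Fine quotient is x + x^2 T. *)
Let T n : rat := \sum_(h < n) b (n - h)%N h.+1.

(** Unfolding [bS] along its last term telescopes N^(k+2) - x N^(k+3) = x (N^(k+1) + 2 N^(k+2)). *)
Let b_split m k :
  b m.+1 k.+2 = \sum_(h < m) (2%:R * b (m - h)%N (h + k).+2 + b (m - h)%N (h + k).+1).
Proof.
elim: m k => [|m IH] k; first by rewrite big_ord0 bS !b0 /=; ring.
rewrite bS (IH k.+1) big_ord_recl /= subn0 add0n.
congr (_ + _); first by rewrite addrC.
by apply: eq_bigr => h _; rewrite [bump 0 h]add1n subSS addSnnS.
Qed.

(** The relation N = x (1 + 2 T + x T), from N = x (1 + 2 N + N^2) with N^2 expanded by
    [b_split]. *)
Let tree_T m : b m.+2 1%N = 2%:R * T m.+1 + T m.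
Proof.
rewrite bS bS0 add0r b_split [T m.+1]big_ord_recl subn0 mulrDr -addrA.
congr (_ + _); rewrite mulr_sumr -big_split /=; apply: eq_bigr => h _.
by rewrite [bump 0 h]add1n subSS addn0.
Qed.

(** The relation x T N = T - N: multiplying by x N shifts the sum defining T by one term. *)
Let T_conv n : \sum_(i < n.+1) T i * b (n - i)%N 1%N = T n.+1 - b n.+1 1%N.
Proof.
(* The added terms have h >= i, so truncated subtraction turns them into constant terms of positive
   powers of N, which are zero. *)
have T_widen (i : 'I_n.+1) : T i = \sum_(h < n) b (i - h)%N h.+1.
  rewrite /T (big_ord_widen n (fun h => b (i - h)%N h.+1)); last by rewrite -ltnS.
  rewrite big_mkcond; apply: eq_bigr => h _; case: ltnP => // le_ih.
  by rewrite (eqP le_ih).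
rewrite [T n.+1]big_ord_recl subn0 addrC addKr.
under eq_bigr do rewrite T_widen mulr_suml.
rewrite exchange_big; apply: eq_bigr => h _; have lt_hn := ltn_ord h.
rewrite lift0 subSS -[h.+2]addn1 -b_conv.
rewrite -(big_mkord predT (fun i => b (i - h)%N h.+1 * b (n - i)%N 1%N)).
rewrite (big_cat_nat _ (ltnW (ltnW lt_hn : (h < n.+1)%N))) //=.
rewrite big_nat big1 ?add0r => [|i /andP[_ lt_ih]]; last first.
  by rewrite (eqP (ltnW lt_ih)) b0 mul0r.
rewrite -{1}[val h]add0n big_addn big_mkord subSn; last exact: ltnW.
by apply: eq_bigr => i _; rewrite addnK addnC subnDA.
Qed.

Let C n : rat := (n == 0%N)%:R + b n 1%N.

(** The Catalan equation C = 1 + x C^2, which is N = x (1 + N)^2. *)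
Let C_conv n : \sum_(i < n.+1) C i * C (n - i)%N = C n.+1.
Proof.
rewrite /C.
under eq_bigr do rewrite mulrDl.
rewrite big_split /= big_ord_recl subn0 mul1r big1 ?addr0 => [|i _]; last by rewrite mul0r.
under eq_bigr do rewrite mulrDr.
rewrite big_split /= b_conv big_ord_recr subnn /= mulr1.
rewrite big1 ?add0r => [|i _]; last by rewrite subn_eq0 leqNgt ltn_ord mulr0.
by rewrite bS; case: n => [|n]; rewrite ?bS0 ?b0 /=; ring.
Qed.

(** By [C_conv], (1 - 2 x C)^2 = 1 - 4 x C + 4 x (C - 1) = 1 - 4 x, and a square root with constant
    term 1 is unique. *)
Let S_coef n : sqrt_1m4x n = if n is k.+1 then - 2%:R * C k else 1.
Proof.
apply: (fps_sqr_inj sqrt_1m4x (fun n => if n is k.+1 then - 2%:R * C k else 1)) => //.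
move=> {}n; rewrite sqrt_1m4xK /fps_poly coefB coef1 coefZ coefX /fps_mul.
case: n => [|n]; first by rewrite big_ord1 /=; ring.
rewrite big_ord_recl big_ord_recr /= [bump 0 n]add1n subnn mul1r mulr1.
have -> : \sum_(i < n) - 2%:R * C i *
    (match (n.+1 - bump 0 i)%N with 0%N => 1 | k.+1 => - 2%:R * C k end) =
    (if n is k.+1 then 4%:R * C k.+1 else 0).
  case: n => [|n]; first by rewrite big_ord0.
  rewrite -C_conv mulr_sumr; apply: eq_bigr => i _.
  by rewrite [bump 0 i]add1n subSS subSn; [ring | rewrite -ltnS].
by case: n => [|n] /=; rewrite /C ?b0 /=; ring.
Qed.

(** After substitution of the square root the claim is (x + x^2 T)(2 + 2 x C) = 2 x C. [T_conv]
    removes the product T N, and what remains is [tree_T]. *)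
Let Q_coef n : fine_quotient n = if n is k.+1 then (if k is m.+1 then T m else 1) else 0.
Proof.
set Q := fun n => if n is k.+1 then (if k is m.+1 then T m else 1) else 0.
have B_coef i : fps_sub (fps_poly 3%:R) sqrt_1m4x i = if i is k.+1 then 2%:R * C k else 2%:R.
  rewrite /fps_sub S_coef /fps_poly -polyC_natr coefC; case: i => [|i] /=; ring.
apply: (fps_mul_inj (fps_sub (fps_poly 3%:R) sqrt_1m4x) fine_quotient Q).
  by rewrite B_coef pnatr_eq0.
move=> {}n; rewrite fine_quotientK /fps_sub S_coef /fps_poly coef1 /fps_mul.
under eq_bigr do rewrite -/(fps_sub (fps_poly 3%:R) sqrt_1m4x _) B_coef.
case: n => [|[|n]].
- by rewrite big_ord1 mul0r /=; ring.
- by rewrite !big_ord_recl big_ord0 /= /C b0 /=; ring.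
rewrite 2!big_ord_recl /= mul0r add0r mul1r.
have -> : \sum_(i < n.+1) T i *
     (match (n.+2 - bump 0 (bump 0 i))%N with 0%N => 2%:R | k.+1 => 2%:R * C k end) =
   2%:R * T n + 2%:R * (if n is m.+1 then T m + (T m.+1 - b m.+1 1%N) else 0).
  rewrite big_ord_recr /= ![bump 0 _]add1n subnn addrC [T n * _]mulrC.
  congr (_ + _); case: n => [|n]; first by rewrite big_ord0 mulr0.
  rewrite -T_conv big_ord_recr [X in T n + X]big_ord_recr /= ![bump 0 _]add1n !subSS.
  rewrite subSnn subnn b0 mulr0 addr0 [in RHS]mulrDr [RHS]addrC; congr (_ + _); last by rewrite /C b0 /=; ring.
  rewrite mulr_sumr; apply: eq_bigr => i _; have lt_in := ltn_ord i.
  rewrite ![bump 0 _]add1n !subSS subSn 1?ltnW //.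
  by rewrite /C subn_eq0 leqNgt lt_in /=; ring.
case: n => [|n]; rewrite /C /=.
  by rewrite /T big_ord0 bS !b0 /=; ring.
by rewrite tree_T; ring.
Qed.

Lemma fine_sum n : fine n.+1 = \sum_(h < n) b (n - h)%N h.+1.
Proof. by rewrite /fine Q_coef. Qed.

End Fine.

Lemma fine_treepow n :
  fine n.+1 = \sum_(h < n) treepow 2%:R 1 (n - h) h.+1.
Proof.
apply: fine_sum.
- exact: treepow0.
- exact: treepowS0.
- by move=> m k; rewrite treepowSS mul1r.
- exact: treepow_conv.
Qed.

(** * Closed formulas *)

Lemma binz_nat (a b : nat) : binz a%:Z b%:Z = 'C(a, b)%:R.
Proof. by rewrite /binz /= lez_nat; case: leqP => // /bin_small->. Qed.

Lemma sum_bin_hockey p m : (\sum_(h < m.+1) 'C(p + m - h, p) = 'C(p + m + 1, m))%N.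
Proof.
elim: m => [|m IH]; first by rewrite big_ord1 addn0 subn0 binn bin0.
rewrite big_ord_recl subn0 [in RHS]addn1 binS; congr (_ + _)%N.
  by rewrite -bin_sub ?leq_addr // addKn.
rewrite addnS -[(p + m).+1]addn1 -IH; apply: eq_bigr => h _.
by rewrite lift0 addn1 subSS.
Qed.

(** Taking one copy of each binomial out of the weight h + 1 leaves a hockey-stick sum and the same
    weighted sum for m - 1; Pascal's rule adds them. *)
Lemma sum_bin_vandermonde p m :
  (\sum_(h < m.+1) h.+1 * 'C(p + m - h, p) = 'C(p + m + 2, m))%N.
Proof.
elim: m => [|m IH]; first by rewrite big_ord1 addn0 subn0 binn bin0.
transitivity (\sum_(h < m.+2) 'C(p + m.+1 - h, p)
    + \sum_(h < m.+1) h.+1 * 'C(p + m - h, p))%N; last first.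
  by rewrite sum_bin_hockey IH !addn2 addn1 addnS binS.
rewrite big_ord_recl [in RHS]big_ord_recl mul1n -addnA -big_split /=.
congr (_ + _)%N; apply: eq_bigr => h _.
by rewrite [bump 0 h]add1n addnS subSS mulSn.
Qed.

Section Statistics.

Variables (n : nat) (n_gt0 : (0 < n)%N).

Let P := stack_preim n (Av n hook_patterns).

Lemma card_preim : #|` P|%:R = fine n.+1.
Proof.
rewrite fine_treepow; transitivity (\sum_(w <- P) (1 : rat)).
  by rewrite big_const_seq count_predT iter_addr_0.
rewrite (sum_preim_treepow _ _ (fun _ _ => 1)) //.
by apply: eq_bigr => h _; rewrite expr1n mul1r.
Qed.

Lemma card_descents m :
  #|` [fset w in P | size (descents w) == m]%fset|%:R =
  \sum_(0 <= k < ((n - 1) %/ 2).+1) narayana k (n - k)%N (m%:Z - k%:Z + 1).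
Proof.
rewrite card_stat (sum_preim_treepow _ _ (fun _ r => 'X^r)) //; last first.
  by move=> L N M hL hM; rewrite size_descents_cat // !exprD.
(* Beyond (n - 1) / 2 one has n - h < h + 1, so the tree powers vanish and both sums can run up to
   n. *)
rewrite coef_sum (big_nat_widen _ _ n) ?big_mkord; last by lia.
rewrite [RHS]big_mkcond; apply: eq_bigr => h _ /=; have lt_hn := ltn_ord h.
rewrite expr0 expr1 coefXnM; case: (ltnP h _) => [_|h_large]; last first.
  by rewrite treepow_small ?coef0 ?if_same //; lia.
rewrite /narayana; have -> : m%:Z - h%:Z + 1 + h%:Z = m.+1%:Z by lia.
have -> : m%:Z - h%:Z + 1 - 1 = m%:Z - h%:Z by lia.
case: ltnP => [lt_mh|le_hm].
  (* Here the lower index m - h is negative, while on the other side the factor y^h exceeds degree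
     m. *)
  by rewrite {2}/binz ifN ?mulr0 //; lia.
have -> : m%:Z - h%:Z = (m - h)%N%:Z by lia.
rewrite !binz_nat treepow_coef ?subn_gt0 // kernelpow_des.
have -> : (h.+1 + (m - h) = m.+1)%N by lia.
by rewrite natrM mulrA mulrAC.
Qed.

Lemma card_peaks m :
  #|` [fset w in P | size (peaks w) == m]%fset|%:R =
  2%:R ^ (n%:Z - 2 * m%:Z - 1) / (n%:R + 2%:R)
    * binz (n%:Z + 2) (m%:Z + 1) * binz (n%:Z - m%:Z - 1) m%:Z.
Proof.
rewrite card_stat (sum_preim_treepow _ _ (fun l r => 'X^(l && r))) //; last first.
  by move=> L N M hL hM; rewrite size_peaks_cat // !exprD.
rewrite coef_sum /= expr0 expr1.
(* The exponent of 2 and the last binomial are independent of h and later leave the sum. *)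
have term (h : 'I_n) : ('X^h * treepow (1 + 1) 'X (n - h) h.+1 : {poly rat})`_m =
    if (h < m.+1)%N then h.+1%:R / (n - h)%:R *
      (2 ^ (n - 1 - m.*2) * 'C(n - h, m - h) * 'C(n - m, m.+1))%:R else 0.
  have lt_hn := ltn_ord h; rewrite coefXnM ltnS; case: leqP => // le_hm.
  rewrite -mulr2n treepow_coef ?subn_gt0 // kernelpow_peak; congr (_ * (_ * _ * _)%:R).
  - by congr (2 ^ _)%N; lia.
  - by congr 'C(_, _); lia.
rewrite (eq_bigr _ (fun h _ => term h)) {term} -big_mkcond /=.
have [lt_2mn|le_n2m] := ltnP m.*2 n; last first.
  rewrite big1 => [|h _]; last by rewrite [X in (_ * X)%N]bin_small ?muln0 ?mulr0 //; lia.
  by rewrite [X in _ * X]/binz ifN ?mulr0 //; lia.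
have [p np] : {p | n = (p + m).+1} by exists (n - m.+1)%N; lia.
rewrite -(big_ord_widen n (fun h => h.+1%:R / (n - h)%:R *
  (2 ^ (n - 1 - m.*2) * 'C(n - h, m - h) * 'C(n - m, m.+1))%:R)); last by lia.
have -> : n%:Z - 2 * m%:Z - 1 = (n - 1 - m.*2)%N%:Z by lia.
have -> : n%:Z - m%:Z - 1 = p%:Z by lia.
have -> : n%:Z + 2 = (p + m).+3%:Z by lia.
have -> : m%:Z + 1 = m.+1%:Z by lia.
have -> : n%:R + 2%:R = (p + m).+3%:R :> rat by rewrite np -natrD addn2.
have -> : (n - m = p.+1)%N by lia.
rewrite !binz_nat -exprnP; set E := (n - 1 - m.*2)%N.
(* With p = n - m - 1, absorption turns C(n-h, p+1) / (n-h) into C(n-h-1, p) / (p+1), so the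
   denominator no longer depends on h. *)
transitivity (2%:R ^+ E * 'C(p.+1, m.+1)%:R / p.+1%:R *
  (\sum_(h < m.+1) h.+1 * 'C(p + m - h, p))%N%:R : rat).
  rewrite natr_sum mulr_sumr; apply: eq_bigr => h _; have le_hm := ltn_ord h.
  have diag : (n - h)%:R * 'C(p + m - h, p)%:R = p.+1%:R * 'C(n - h, m - h)%:R :> rat.
    rewrite -!natrM -[p.+1]/(p.+1) (_ : 'C(n - h, m - h) = 'C(n - h, p.+1)).
      by rewrite -mul_bin_diag; congr (_ * 'C(_, _))%:R; lia.
    by rewrite -bin_sub; [congr 'C(_, _) | ]; lia.
  have nh0 : (n - h)%:R != 0 :> rat by rewrite pnatr_eq0; lia.
  have p0 : p.+1%:R != 0 :> rat by rewrite pnatr_eq0.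
  rewrite !natrM natrX.
  have -> : 'C(n - h, m - h)%:R = (n - h)%:R * 'C(p + m - h, p)%:R / p.+1%:R :> rat.
    by rewrite diag mulrAC divff // mul1r.
  move: (n - h)%:R p.+1%:R nh0 p0 => x y nh0 p0; field.
  by rewrite nh0 p0.
rewrite sum_bin_vandermonde addn2.
have d1 : p.+1%:R * 'C(p, m)%:R = m.+1%:R * 'C(p.+1, m.+1)%:R :> rat.
  by rewrite -!natrM mul_bin_diag.
have d2 : (p + m).+3%:R * 'C((p + m).+2, m)%:R = m.+1%:R * 'C((p + m).+3, m.+1)%:R :> rat.
  by rewrite -!natrM mul_bin_diag.
have m0 : m.+1%:R != 0 :> rat by rewrite pnatr_eq0.
have p0 : p.+1%:R != 0 :> rat by rewrite pnatr_eq0.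
have q0 : (p + m).+3%:R != 0 :> rat by rewrite pnatr_eq0.
have -> : 'C(p.+1, m.+1)%:R = p.+1%:R * 'C(p, m)%:R / m.+1%:R :> rat.
  by rewrite d1 mulrAC divff // mul1r.
have -> : 'C((p + m).+3, m.+1)%:R = (p + m).+3%:R * 'C((p + m).+2, m)%:R / m.+1%:R :> rat.
  by rewrite d2 mulrAC divff // mul1r.
move: (m.+1%:R) p.+1%:R (p + m).+3%:R m0 p0 q0 => x y z x0 y0 z0; field.
by rewrite x0 y0 z0.
Qed.

End Statistics.

Theorem theorem7p3 (n : nat) (hn : (1 <= n)%N) :
  let P := stack_preim n (Av n [:: [:: 1; 3; 2]; [:: 2; 3; 1]; [:: 3; 1; 2]]%N) in
  [/\ #|` P|%:R = fine n.+1,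
      forall m : nat,
        #|` [fset w in P | size (descents w) == m]%fset|%:R =
        \sum_(0 <= k < ((n - 1) %/ 2).+1)
           narayana k (n - k)%N (m%:Z - k%:Z + 1)
    & forall m : nat,
        #|` [fset w in P | size (peaks w) == m]%fset|%:R =
        2%:R ^ (n%:Z - 2 * m%:Z - 1) / (n%:R + 2%:R)
          * binz (n%:Z + 2) (m%:Z + 1) * binz (n%:Z - m%:Z - 1) m%:Z].
Proof.
split.
- exact: card_preim.
- exact: card_descents.
- exact: card_peaks.
Qed.
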